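(* Let $D$ be a digraph, $L$ be a list assignment of $D$, and $k$ be an integer. If for every vertex $v\in V(D)$ and for every colour $c\in L(v)$, we have $$|N^+(v)\cap\{u : c\in L(u)\}|\leq k\qquad\text{and}\qquad |N^-(v)\cap\{u : c\in L(u)\}|\leq |L(v)|-k,$$ then $D$ is $L$-dicolourable.
   Context: Digraphs are finite, without loops and without parallel arcs (two opposite arcs $uv$ and $vu$ are allowed and form a digon). $N^+(v)$ and $N^-(v)$ are the out- and in-neighbourhoods of $v$ in $D$. A list assignment $L$ of $D$ is a map that associates a list (set) $L(v)$ of colours to every vertex $v$ of $D$. A dicolouring of $D$ is a colouring of $V(D)$ such that each colour class induces an acyclic subdigraph of $D$ (one with no directed cycle; a digon is a directed cycle of length 2). An $L$-dicolouring of $D$ is a dicolouring $\alpha$ of $D$ such that $\alpha(v)\in L(v)$ for every vertex $v$ of $D$, and $D$ is $L$-dicolourable if it admits an $L$-dicolouring.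
   Formalization: Every list L(v) is assumed nonempty; without this the claim fails, e.g. for a single vertex with an empty list, where the degree conditions hold vacuously but no L-dicolouring exists. *)

(* Defs.v *)
From HB Require Import structures.
From mathcomp Require Import all_boot all_order all_algebra finmap.
Set Implicit Arguments.
Unset Strict Implicit.
Unset Printing Implicit Defensive.

(* Arcs form a relation, so there are no parallel arcs; digons are allowed. *)
Record digraph := Digraph {
  vertex :> finType;
  arc : rel vertex;
  arc_irr : irreflexive arc
}.

Definition out_nbr (D : digraph) (v : D) : {set D} := [set u | arc v u].
Definition in_nbr (D : digraph) (v : D) : {set D} := [set u | arc u v].

Definition induced_arc (D : digraph) (S : {set D}) : rel {x : D | x \in S} :=
  fun x y => arc (val x) (val y).

Lemma induced_arc_irr (D : digraph) (S : {set D}) :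
  irreflexive (@induced_arc D S).
Proof. by move=> x; apply: arc_irr. Qed.

Definition induced (D : digraph) (S : {set D}) : digraph :=
  Digraph (@induced_arc_irr D S).

(* [ucycle arc p] holds of the empty sequence and of the directed cycles
   (listed without repetition); length 1 is ruled out by [arc_irr]. *)
Definition acyclic (D : digraph) : Prop :=
  forall p : seq D, ucycle (@arc D) p -> p = [::].

Section Dicolouring.
Variables (D : digraph) (C : choiceType).

Definition colour_class (alpha : D -> C) (c : C) : {set D} :=
  [set v | alpha v == c].

Definition dicolouring (alpha : D -> C) : Prop :=
  forall c : C, acyclic (induced (colour_class alpha c)).

Definition list_assignment : Type := D -> {fset C}.

Definition list_dicolouring (L : list_assignment) (alpha : D -> C) : Prop :=
  dicolouring alpha /\ forall v : D, alpha v \in L v.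

Definition list_dicolourable (L : list_assignment) : Prop :=
  exists alpha : D -> C, list_dicolouring L alpha.

End Dicolouring.

(* Main.v *)
Require Import Defs.
From HB Require Import structures.
From mathcomp Require Import all_boot all_order all_algebra finmap.
From mathcomp Require Import zify.
Set Implicit Arguments.
Unset Strict Implicit.
Unset Printing Implicit Defensive.
Import Order.TTheory GRing.Theory Num.Theory.

(** Pass to the digraph H whose vertices are the pairs (v, c) with c in L(v),
    with an arc from (u, c) to (v, c) for each arc uv of D, and split its
    vertices into the parts {v} x L(v).  Choosing a colour from every list is
    choosing a transversal of the parts, and the colouring is a dicolouring as
    soon as the transversal spans no directed cycle of H.  The hypotheses say
    that every out-degree of H is at most k and that every in-degree is at most
    the size of the part minus k.  So it suffices to prove a directed version
    of Haxell's theorem on independent transversals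
    ([acyclic_transversal_exists]); the digraphs in which all arcs lie in
    digons give back the undirected case.

    The transversal is built one part at a time.  Let T be an acyclic
    transversal of some of the parts and let r be a part that T misses.  A
    vertex w without out-neighbours in T can always be put into T, in place of
    the vertex of T in the part of w if there is one: w becomes a sink, so no
    cycle appears ([replace_sink]).  If w is in r, then T has been extended.
    In general one keeps a set A of vertices waiting to be put into T, and the
    set B of their out-neighbours in T, which block them; each vertex added to
    A brings at least one new blocker, so |A| <= |B|.  The parts of interest are
    r and the parts of the vertices of B.  Together they have more vertices than
    A and B dominate: A has at most k|A| <= k|B| out-neighbours, a vertex b of B
    has at most (size of its part) - k in-neighbours, and the part r is left
    over.  So ([undominated_vertex]) one of these parts contains a vertex w that
    receives no arc from A and sends none to B.  If w has out-neighbours in T,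
    then w joins A.  If it has none, then it is put into T, either in r, or in
    place of a blocker of A, and in the second case some vertex of A has lost
    a blocker.  That this process ends is the content of
    [alternating_search]. *)

Lemma leq_card_bigcup (I T : finType) (A : {set I}) (F : I -> {set T}) :
  #|\bigcup_(i in A) F i| <= \sum_(i in A) #|F i|.
Proof.
elim/big_rec2: _ => [|i n X _ leXn]; first by rewrite cards0.
by apply: leq_trans (leq_card_setU _ _) _; rewrite leq_add2l.
Qed.

(** * Acyclic transversals *)

Section AcyclicTransversal.
Local Open Scope nat_scope.
Variables (V P : finType) (e : rel V) (f : V -> P).
Hypothesis e_irr : irreflexive e.

(** For a finite loopless digraph this is equivalent to the absence of directed
    cycles in [T]. In this form, acyclicity visibly survives the addition of a
    vertex without out-neighbours in [T]. *)
Definition hereditary_sinks (T : {set V}) : Prop :=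
  forall X : {set V}, X \subset T -> X != set0 ->
    exists2 x, x \in X & forall y, y \in X -> ~~ e x y.

Definition acyclic_transversal (U : {set P}) (T : {set V}) : Prop :=
  [/\ {in T &, injective f}, f @: T = U & hereditary_sinks T].

(** One operation covers the extension of [T] into a new part and the exchange
    of a vertex of [T] inside its part. *)
Definition replace (T : {set V}) (w : V) : {set V} :=
  w |: [set t in T | f t != f w].

Definition out_nbrs_in (T A : {set V}) : {set V} :=
  [set t in T | [exists a in A, e a t]].

Lemma out_nbrs_inP (T A : {set V}) t :
  reflect (t \in T /\ exists2 a, a \in A & e a t) (t \in out_nbrs_in T A).
Proof.
rewrite inE; apply: (iffP andP) => -[tT].
  by move/exists_inP.
by move=> h; split=> //; apply/exists_inP.
Qed.

Lemma out_nbrs_in1P (T : {set V}) w t :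
  reflect (t \in T /\ e w t) (t \in out_nbrs_in T [set w]).
Proof.
apply: (iffP (out_nbrs_inP _ _ _)) => -[tT].
  by case=> a /set1P->.
by move=> ewt; split=> //; exists w; rewrite ?set11.
Qed.

(** A subset of the new set either contains [w], which is then a sink of it, or
    is a subset of [T]. *)
Lemma replace_sink (U : {set P}) (T : {set V}) (w : V) :
    acyclic_transversal U T -> (forall t, t \in T -> ~~ e w t) ->
  acyclic_transversal (f w |: U) (replace T w).
Proof.
move=> [injT imT sinkT] wT; split.
- move=> x y /setU1P[->|]; [|rewrite inE => /andP[xT xw]];
    case/setU1P=> [->|]; rewrite ?inE //.
  + by case/andP=> _ /negbTE yw fwy; rewrite fwy eqxx in yw.
  + by move=> fxw; rewrite fxw eqxx in xw.
  + by case/andP=> yT _; apply: injT.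
- apply/setP=> p; apply/imsetP/setU1P => [[x]|].
    case/setU1P=> [->|]; first by left.
    by rewrite inE => /andP[xT _] ->; right; rewrite -imT imset_f.
  have [-> _|pw [/eqP|]] := eqVneq p (f w); first by exists w; rewrite ?setU11.
    by rewrite (negbTE pw).
  rewrite -imT => /imsetP[t tT pt]; exists t => //.
  by apply/setU1P; right; rewrite inE tT -pt.
- move=> X subX X0; have [wX|wX] := boolP (w \in X).
    exists w => // y /(subsetP subX) /setU1P[->|]; first by rewrite e_irr.
    by rewrite inE => /andP[/wT].
  apply: sinkT => //; apply/subsetP => x xX.
  have /setU1P[xw|] := subsetP subX x xX; first by rewrite -xw xX in wX.
  by rewrite inE => /andP[].
Qed.

Variable k : nat.
Hypothesis out_le : forall v, #|[set y | e v y]| <= k.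
Hypothesis in_le : forall v, #|[set x | e x v]| + k <= #|f @^-1: [set f v]|.
Hypothesis part_neq0 : forall p, f @^-1: [set p] != set0.

(** The parts that meet [B] have at least as many vertices as [A] and [B]
    dominate: in the part of each vertex [b], [k] vertices pay for the
    out-neighbours of one vertex of [A], and the others pay for the in-neighbours
    of [b]. The vertices in part [r] are the surplus. *)
Lemma undominated_vertex (r : P) (A B : {set V}) :
    {in B &, injective f} -> r \notin f @: B -> #|A| <= #|B| ->
  exists w, [/\ f w \in r |: f @: B, forall a, a \in A -> ~~ e a w
              & forall b, b \in B -> ~~ e w b].
Proof.
move=> injB rB leAB.
pose S := r |: f @: B.
pose O := \bigcup_(a in A) [set y | e a y].
pose I := \bigcup_(b in B) [set x | e x b].
have cardS :
    #|f @^-1: S| = #|f @^-1: [set r]| + \sum_(b in B) #|f @^-1: [set f b]|.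
  rewrite -sum1_card (partition_big f (fun p => p \in S)) => [|v]; last first.
    by rewrite inE.
  transitivity (\sum_(p in S) #|f @^-1: [set p]|).
    apply: eq_bigr => p pS; rewrite -sum1_card; apply: eq_bigl => v.
    rewrite !inE; case: (f v =P p) => [->|]; rewrite ?andbF //.
    by move: pS; rewrite !inE => ->.
  by rewrite big_setU1 //= big_imset.
have cardO : #|O| <= \sum_(a in A) k.
  by apply: leq_trans (leq_card_bigcup _ _) _; apply: leq_sum.
have cardI : #|I| + #|B| * k <= \sum_(b in B) #|f @^-1: [set f b]|.
  rewrite -sum_nat_const.
  apply: leq_trans (leq_add (leq_card_bigcup _ _) (leqnn _)) _.
  by rewrite -big_split; apply: leq_sum.
have : ~~ (f @^-1: S \subset O :|: I).
  apply/negP => /subset_leq_card; rewrite cardS leqNgt => /negP[].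
  apply: leq_ltn_trans (leq_card_setU _ _) _.
  rewrite sum_nat_const in cardO.
  have := part_neq0 r; rewrite -card_gt0.
  have := leq_mul leAB (leqnn k); lia.
case/subsetPn=> w; rewrite !inE => wS /norP[/bigcupP wO /bigcupP wI].
exists w; split=> [|a aA|b bB]; first by rewrite !inE.
  by apply/negP=> eaw; apply: wO; exists a; rewrite ?inE.
by apply/negP=> ewb; apply: wI; exists b; rewrite ?inE.
Qed.

(** The search for an augmentation, with the waiting vertices [A] and their
    blockers [B]. The predicate [G] describes the configurations that count as
    progress for the caller, and the hypothesis on [G] says that replacing a
    vertex of [T] by a sink in a part of interest is progress. At the top level
    progress means covering the part [r]. When a vertex [w] with blockers
    [W] joins [A], the search is called again with a weaker goal: either [G], or
    the same blockers for [A] but fewer blockers for [w]. The outer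
    induction is on the number of vertices outside [B], which the recursive call
    decreases; the inner induction is on the number of blockers of [w], and it
    keeps the same [w], because being undominated depends only on [A] and [B]. *)
Lemma alternating_search (U : {set P}) (r : P) (A B : {set V})
    (G : {set V} -> Prop) (T : {set V}) :
    r \notin U -> #|A| <= #|B| ->
    (forall T w, acyclic_transversal U T -> out_nbrs_in T A = B ->
       f w \in r |: f @: B -> (forall a, a \in A -> ~~ e a w) ->
       (forall t, t \in T -> ~~ e w t) -> G (replace T w)) ->
    acyclic_transversal U T -> out_nbrs_in T A = B ->
  exists T', G T'.
Proof.
move=> rU; have [n] := ubnP (#|V| - #|B|).
elim: n A B G T => // n IHn A B G T ltn leAB closedG trT BE.
have [injT imT _] := trT.
have subBT : B \subset T by rewrite -BE; apply/subsetP=> b /out_nbrs_inP[].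
have [||w [wS Aw wB]] := @undominated_vertex r A B _ _ leAB.
- by move=> x y xB yB; apply: injT; apply: (subsetP subBT).
- by apply: contra rU; rewrite -imT; apply/subsetP/imsetS.
have [m] := ubnP #|out_nbrs_in T [set w]|.
elim: m T trT BE {injT imT subBT} => // m IHm T trT BE ltm.
set W := out_nbrs_in T [set w] in ltm.
have [W0|Wn0] := eqVneq W set0.
  exists (replace T w); apply: closedG => // t tT; apply/negP => ewt.
  by have : t \in W; [apply/out_nbrs_in1P | rewrite W0 inE].
(* The blockers of [w] are new, because [w] sends no arc to [B]. So [w] may
   join [A] without breaking the inequality between the cardinals. *)
have disjBW : [disjoint B & W].
  by apply/pred0P=> t /=; apply/andP=> -[/wB/negP nwt /out_nbrs_in1P[_ /nwt]].
have cardBW : #|B :|: W| = #|B| + #|W|.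
  by apply/eqP; rewrite (leq_card_setU B W).
have W_gt0 : 0 < #|W| by rewrite card_gt0.
pose better T' := [/\ acyclic_transversal U T', out_nbrs_in T' A = B
                    & #|out_nbrs_in T' [set w]| < #|W|].
have [| | | | |T' []] := IHn (w |: A) (B :|: W) (fun T' => G T' \/ better T') T.
- have := max_card (B :|: W); rewrite cardBW; lia.
- rewrite cardsU1 cardBW; case: (_ \notin _) => /=; lia.
- move=> T1 w1 trT1 hit1 w1S w1A w1T1.
  have [injT1 imT1 _] := trT1.
  have subT1 t : t \in B :|: W -> t \in T1 by rewrite -hit1 => /out_nbrs_inP[].
  (* Only the union of the blockers is known for [T1]. Nothing in [W] is a
     blocker of [A] and nothing in [B] is a blocker of [w], so each of [A] and
     [w] has no blocker that it did not have before. *)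
  have B1 : out_nbrs_in T1 A = B.
    apply/setP=> t; apply/idP/idP => [/out_nbrs_inP[tT1 [a aA eat]]|tB].
      have : t \in B :|: W.
        rewrite -hit1; apply/out_nbrs_inP; split=> //.
        by exists a; rewrite ?inE ?aA ?orbT.
      case/setUP=> // /out_nbrs_in1P[tT _].
      by rewrite -BE; apply/out_nbrs_inP; split=> //; exists a.
    apply/out_nbrs_inP; split; first by rewrite subT1 // inE tB.
    by move: tB; rewrite -BE => /out_nbrs_inP[].
  have W1 : out_nbrs_in T1 [set w] \subset W.
    apply/subsetP=> t /out_nbrs_in1P[tT1 ewt].
    have : t \in B :|: W.
      rewrite -hit1; apply/out_nbrs_inP; split=> //.
      by exists w; rewrite ?setU11.
    by case/setUP=> // /wB; rewrite ewt.
  have [w1B|w1B] := boolP (f w1 \in r |: f @: B).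
    by left; apply: closedG => // a aA; apply: w1A; rewrite inE aA orbT.
  (* Otherwise [w1] takes the place of a blocker [t] of [w], and as it receives
     no arc from [w |: A] it does not become a blocker itself. *)
  right.
  have [t tW w1t] : exists2 t, t \in W & f w1 = f t.
    by move: w1S w1B; rewrite imsetU setUA inE => /orP[->//|/imsetP].
  have tT1 : t \in T1 by apply: subT1; rewrite inE tW orbT.
  split.
  + have -> : U = f w1 |: U.
      by apply/esym/setUidPr; rewrite sub1set w1t -imT1 imset_f.
    exact: replace_sink.
  + apply/setP=> s; apply/idP/idP => [/out_nbrs_inP[]|sB].
      case/setU1P=> [->|].
        by case=> a aA; rewrite (negbTE (w1A a _)) // inE aA orbT.
      by rewrite inE => /andP[sT1 _] sA; rewrite -B1; apply/out_nbrs_inP.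
    move: (sB); rewrite -B1 => /out_nbrs_inP[sT1 sA].
    apply/out_nbrs_inP; split=> //.
    rewrite !inE sT1 /= orbC; apply/orP; left.
    by apply: contra w1B => /eqP <-; rewrite inE imset_f ?orbT.
  + apply: proper_card; apply/properP; split.
      apply/subsetP=> s /out_nbrs_in1P[/setU1P[->|]].
        by rewrite (negbTE (w1A w _)) ?setU11.
      by rewrite inE => /andP[sT1 _] ews; apply/(subsetP W1)/out_nbrs_in1P.
    exists t => //; apply/negP=> /out_nbrs_in1P[/setU1P[tw1|]]; last first.
      by rewrite inE w1t eqxx andbF.
    by case/out_nbrs_in1P: tW; rewrite tw1 (negbTE (w1A w _)) ?setU11.
- exact: trT.
- apply/setP=> t; apply/out_nbrs_inP/setUP => [[tT [a /setU1P[->|aA] eat]]|].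
  + by right; apply/out_nbrs_in1P.
  + by left; rewrite -BE; apply/out_nbrs_inP; split=> //; exists a.
  + case=> [|/out_nbrs_in1P[tT ewt]]; last first.
      by split=> //; exists w; rewrite ?setU11.
    rewrite -BE => /out_nbrs_inP[tT [a aA eat]]; split=> //.
    by exists a; rewrite ?inE ?aA ?orbT.
- by move=> GT'; exists T'.
- case=> trT' BE' ltT'; apply: (IHm T') => //.
  by apply: leq_trans ltT' _; rewrite -ltnS.
Qed.

(** A directed version of Haxell's theorem. The search starts with nothing
    waiting, and then the only part of interest is the one to be covered. *)
Theorem acyclic_transversal_exists : exists T, acyclic_transversal setT T.
Proof.
suff all_sets n (U : {set P}) : #|U| = n -> exists T, acyclic_transversal U T.
  exact: all_sets erefl.
elim: n U => [|n IHn] U cardU.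
  move/eqP: cardU; rewrite cards_eq0 => /eqP->; exists set0; split.
  - by move=> x y; rewrite inE.
  - exact: imset0.
  - by move=> X; rewrite subset0 => /eqP-> /eqP.
have /card_gt0P[r rU] : 0 < #|U| by rewrite cardU.
have [|T trT] := IHn (U :\ r).
  by rewrite (cardsD1 r) rU in cardU; case: cardU.
apply: (@alternating_search (U :\ r) r set0 set0 _ T) => //.
- by rewrite !inE eqxx.
- move=> T1 w trT1 _; rewrite imset0 setU0 inE => /eqP fw _ wT1.
  by rewrite -(setD1K rU) -fw; apply: replace_sink; rewrite ?fw.
- apply/setP=> t; rewrite in_set0; apply/negbTE/negP => /out_nbrs_inP[_ [a]].
  by rewrite in_set0.
Qed.

End AcyclicTransversal.

Local Open Scope fset_scope.
Local Open Scope ring_scope.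

(** * From transversals to dicolourings *)

Section ColourGraph.
Variables (D : digraph) (C : choiceType) (L : list_assignment D C).

Definition coloured_vertex : finType := {v : D & L v}.

Definition colour (x : coloured_vertex) : C := val (tagged x).

Definition colour_arc : rel coloured_vertex :=
  fun x y => Defs.arc (tag x) (tag y) && (colour x == colour y).

Lemma colour_mem x : colour x \in L (tag x).
Proof. exact: valP. Qed.

Lemma coloured_vertex_inj x y : tag x = tag y -> colour x = colour y -> x = y.
Proof.
case: x y => [v c] [v' c'] /= vv'; rewrite -{v'}vv' in c' *.
by rewrite /colour /= => /val_inj->.
Qed.

Lemma card_colour_class_le (c : C) (A : {set coloured_vertex}) (B : {set D}) :
    (forall x, x \in A -> colour x = c /\ tag x \in B) ->
  (#|A| <= #|B :&: [set u | c \in L u]|)%N.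
Proof.
move=> AB; rewrite -(card_in_imset (f := tag) (D := mem A)).
  apply/subset_leq_card/subsetP=> _ /imsetP[x xA ->].
  by have [<- xB] := AB x xA; rewrite !inE xB colour_mem.
move=> x y /AB[xc _] /AB[yc _] xy.
by apply: coloured_vertex_inj; rewrite ?xc.
Qed.

Lemma card_list_part (v : D) :
  #|(tag : coloured_vertex -> D) @^-1: [set v]| = #|` L v|.
Proof.
rewrite cardfE -cardsT -(card_imset _ (@eq_from_Tagged _ (fun v => L v) v)).
apply: eq_card => x; rewrite !inE; apply/eqP/imsetP => [xv|[c _ ->]] //.
by case: x xv => u c /= uv; rewrite -uv; exists c.
Qed.

(** A monochromatic directed cycle of [D] would lift to a set of vertices of the
    transversal in which each one has its successor as an out-neighbour. *)
Lemma dicolouring_of_transversal (T : {set coloured_vertex}) :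
  acyclic_transversal colour_arc tag setT T -> list_dicolourable L.
Proof.
case=> _ imT sinkT.
have /fin_all_exists[h hP] : forall v, exists x, x \in T /\ tag x = v.
  by move=> v; have := in_setT v; rewrite -imT => /imsetP[x xT ->]; exists x.
exists (fun v => colour (h v)); split=> [c p|v]; last first.
  by rewrite -{2}(hP v).2 colour_mem.
case: p => [//|x0 p] /andP[cyc _].
have [| |x /imsetP[u up ->] sink] := sinkT [set h (val u) | u in x0 :: p].
- by apply/subsetP=> _ /imsetP[u _ ->]; case: (hP (val u)).
- by apply/set0Pn; exists (h (val x0)); rewrite imset_f ?mem_head.
have colc (y : {v | v \in colour_class (fun v => colour (h v)) c}) :
    colour (h (val y)) = c.
  by apply/eqP; have := valP y; rewrite inE.
have /sink/negP[] :
    h (val (next (x0 :: p) u)) \in [set h (val u) | u in x0 :: p].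
  by rewrite imset_f ?mem_next.
rewrite /colour_arc !(hP _).2 !colc eqxx andbT.
exact: next_cycle cyc up.
Qed.

End ColourGraph.

Theorem corollary5p5 (D : digraph) (C : choiceType) (L : list_assignment D C)
    (k : int)
    (L_nonempty : forall v : D, L v != fset0)
    (degree_bounds : forall (v : D) (c : C), c \in L v ->
       (#|out_nbr v :&: [set u | c \in L u]|%:Z <= k) /\
       (#|in_nbr v :&: [set u | c \in L u]|%:Z <= #|` L v|%:Z - k)) :
  list_dicolourable L.
Proof.
(* The absolute value only matters for a [D] without vertices, as otherwise
   the bound on out-neighbours forces [0 <= k]. *)
have [|x|x|v|T] := @acyclic_transversal_exists (coloured_vertex L) D
  (@colour_arc D C L) tag _ `|k|%N _ _ _.
- by move=> x; rewrite /colour_arc arc_irr.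
- have [out_le _] := degree_bounds _ _ (colour_mem x).
  suff : (#|[set y | colour_arc x y]|
           <= #|out_nbr (tag x) :&: [set u | colour x \in L u]|)%N by lia.
  by apply: card_colour_class_le => y; rewrite !inE => /andP[-> /eqP->].
- have [out_le in_le] := degree_bounds _ _ (colour_mem x).
  rewrite card_list_part.
  suff : (#|[set y | colour_arc y x]|
           <= #|in_nbr (tag x) :&: [set u | colour x \in L u]|)%N by lia.
  by apply: card_colour_class_le => y; rewrite !inE => /andP[-> /eqP->].
- by rewrite -card_gt0 card_list_part cardfs_gt0.
- exact: dicolouring_of_transversal.
Qed.
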